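(* Let $G$ be a connected $k$-regular multigraph of order $n$ (loops and multiple edges allowed), with only $d+1$ distinct eigenvalues $\tau_0=k,\tau_1,\ldots,\tau_d$. Let $F_G(x)=\prod_{i=1}^d (x-\tau_i)$, and let $f_0,\ldots,f_d$ be the real numbers determined by the expression $F_G(x)=\sum_{i=0}^d f_i F_i^{(k)}(x)$. Then $$n\leq \sum_{i\in\{0,\ldots,d\}:\, f_i>0} k_i,$$ where $k_0=1$ and $k_i=k(k-1)^{i-1}$ for $i\geq 1$.
   Context: A multigraph $G=(V,E)$ is finite and undirected, and may have multiple edges and loops. For $u,v\in V$, $m(u,v)$ is the number of edges between $u$ and $v$ if $u\neq v$, and the number of loops on $u$ if $u=v$. The order of $G$ is $n=|V|$. The adjacency matrix of $G$ is the symmetric matrix $A$ indexed by $V$ with $(u,v)$-entry $m(u,v)$ (so each loop contributes $1$ to the diagonal). $G$ is $k$-regular if $\sum_{v\in V} m(u,v)=k$ for each $u\in V$ (so each loop contributes $1$ to the degree). The eigenvalues of $G$ are the eigenvalues of $A$. The polynomials $F_i^{(k)}$ (of degree $i$) are defined by $F_0^{(k)}(x)=1$, $F_1^{(k)}(x)=x$, $F_2^{(k)}(x)=x^2-k$, and $F_i^{(k)}(x)=xF_{i-1}^{(k)}(x)-(k-1)F_{i-2}^{(k)}(x)$ for $i\geq 3$. *)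

(* Defs.v *)
From mathcomp Require Import all_boot all_order all_algebra.

Set Implicit Arguments.
Unset Strict Implicit.
Unset Printing Implicit Defensive.

Import Order.TTheory GRing.Theory Num.Theory.
Local Open Scope ring_scope.

(* A loop is an edge whose set of endpoints is a singleton; distinct edges
   may have the same set of endpoints. *)
Record multigraph := Multigraph {
  vertex : finType;
  edge : finType;
  ends : edge -> {set vertex};
  card_ends : forall e, (0 < #|ends e| <= 2)%N
}.

Definition mg_order (G : multigraph) : nat := #|vertex G|.

(* When u = v the set [set u; v] is [set u], so this counts the loops on u,
   each of them once. *)
Definition mult (G : multigraph) (u v : vertex G) : nat :=
  #|[set e : edge G | ends e == [set u; v]]|.

Definition mg_connected (G : multigraph) : Prop :=
  forall u v : vertex G, connect (fun x y => (0 < mult x y)%N) u v.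

Definition mg_regular (G : multigraph) (k : nat) : Prop :=
  forall u : vertex G, (\sum_(v : vertex G) mult u v)%N = k.

Definition adjacency (R : pzRingType) (G : multigraph) : 'M[R]_(mg_order G) :=
  \matrix_(i, j) (mult (enum_val i) (enum_val j))%:R.

(* The subtraction k - 1 takes place in R, so it is not truncated at k = 0. *)
Fixpoint nbpoly (R : comNzRingType) (k i : nat) : {poly R} :=
  match i with
  | 0 => 1
  | 1 => 'X
  | 2 => 'X^2 - (k%:R)%:P
  | (i2.+1 as i1).+1 => 'X * nbpoly R k i1 - (k%:R - 1)%:P * nbpoly R k i2
  end.

(* At k = 0 the truncation in k.-1 is harmless because of the factor k. *)
Definition nbnum (k i : nat) : nat :=
  if i is i'.+1 then (k * k.-1 ^ i')%N else 1%N.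

(* Main.v *)
Require Import Defs.
From mathcomp Require Import all_boot all_order all_algebra.
From mathcomp Require Import complex.
From mathcomp Require Import zify lra.

(* Let A be the adjacency matrix and F the product of the X - tau_i, i > 0.
   Since A is symmetric, (A - k) F(A) = 0; by connectivity the eigenspace of k
   is spanned by the constant vector, and no eigenvalue exceeds k, so F(A) is a
   matrix with all its entries equal to F(k) / n > 0.  On the other hand the
   (u, v) entry of F_l(A) is the number of non-backtracking walks of length l
   from u to v.  Hence any two vertices u and v are joined by such a walk whose
   length l satisfies f_l > 0; there are k_l non-backtracking walks of length l
   starting at a given vertex u, which bounds the number of vertices v. *)

Set Implicit Arguments.
Unset Strict Implicit.
Unset Printing Implicit Defensive.

Import Order.TTheory GRing.Theory Num.Theory.
Local Open Scope ring_scope.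

(** * Polynomials in a symmetric matrix *)

Lemma horner_mx_eigen (R : comNzRingType) n (A : 'M[R]_n.+1) (v : 'cV[R]_n.+1)
    (a : R) (p : {poly R}) :
  A *m v = a *: v -> horner_mx A p *m v = p.[a] *: v.
Proof.
move=> Av; elim/poly_ind: p => [|p c IHp].
  by rewrite rmorph0 horner0 mul0mx scale0r.
rewrite rmorphD rmorphM /= horner_mx_X horner_mx_C mulmxDl -[_ * A]/(_ *m A).
by rewrite -mulmxA Av -scalemxAr IHp hornerMXaddC scalerDl mul_scalar_mx scalerA
  mulrC.
Qed.

(** Over the complex extension [A] is Hermitian, hence unitarily diagonalizable with real spectrum,
    and [p] vanishes at each diagonal entry. *)
Lemma symmetric_horner_eq0 (R : rcfType) n (A : 'M[R]_n.+1) (p : {poly R}) :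
  A^T = A -> (forall a, eigenvalue A a -> root p a) -> horner_mx A p = 0.
Proof.
move=> symA rootp; pose toC : {rmorphism R -> R[i]%C} := real_complex R.
pose B := map_mx toC A.
have hermB : B \is hermsymmx.
  apply: realsym_hermsym.
    by apply/is_hermitianmxP; rewrite expr0 scale1r map_mx_id // /B map_trmx symA.
  by apply/mxOverP => i j; rewrite mxE; apply/complex_realP; exists (A i j).
have Breal := hermitian_spectral_diag_real hermB.
have /orthomx_spectralP := hermitian_normalmx hermB.
set P := spectralmx B; set D := spectral_diag B => defB.
have Punit : P \in unitmx by exact: spectral_unit.
apply: (map_mx_inj (f := toC)); rewrite map_horner_mx map_mx0 -/B defB.
rewrite horner_mx_uconjC // horner_mx_diag.
suff -> : map_mx (horner (map_poly toC p)) D = 0 by rewrite raddf0 mulmx0 mul0mx.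
apply/rowP => j; rewrite !mxE.
have /complex_realP[x Dx] := mxOverP Breal 0 j.
have -> : D 0 j = toC x by [].
rewrite horner_map; have /eqP-> : root p x; last by rewrite rmorph0.
apply: rootp; rewrite -(eigenvalue_map toC) -/B.
(* Eigenvectors are row vectors here; row [j] of [P] is one, nonzero since [P] is invertible. *)
apply/eigenvalueP; exists (row j P); last first.
  apply: contraTneq Punit => /(congr1 (mulmx^~ (invmx P))) rowP0.
  apply/negP => Punit; move: rowP0; rewrite -row_mul mulmxV // mul0mx.
  by move/rowP/(_ j); rewrite !mxE eqxx => /eqP; rewrite oner_eq0.
rewrite -row_mul {1}defB !mulmxA mulmxV // mul1mx.
by apply/rowP => i; rewrite mul_diag_mx !mxE Dx.
Qed.

(* N l i j plays the role of the number of non-backtracking walks of length l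
   from i to j. *)
Lemma order_le_of_walk_counts (R : rcfType) (n k d : nat) (A : 'M[R]_n)
    (tau f : 'I_d.+1 -> R) (N : nat -> 'I_n -> 'I_n -> nat) :
  A^T = A -> A *m const_mx 1 = k%:R *: const_mx 1 :> 'cV_n ->
  (forall x : 'cV[R]_n, A *m x = k%:R *: x -> exists c, x = const_mx c) ->
  (forall a, eigenvalue A a -> a <= k%:R) ->
  injective tau -> tau ord0 = k%:R ->
  (forall x, eigenvalue A x <-> exists i, x = tau i) ->
  \prod_(i < d.+1 | i != ord0) ('X - (tau i)%:P)
    = \sum_(i < d.+1) f i *: nbpoly R k i ->
  (forall i j, N 0 i j = (i == j)) ->
  (forall i j, A i j = (N 1 i j)%:R) ->
  (forall l i j, (N l.+2 i j + k * N l i j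
     = \sum_m N 1 i m * N l.+1 m j + (l != 0) * N l i j)%N) ->
  (forall l i, (\sum_j N l i j = nbnum k l)%N) ->
  (n <= \sum_(l < d.+1 | (0 < f l)%R) nbnum k l)%N.
Proof.
case: n A N => [//|n] A N symA A1 kerA leA tau_inj tau0 tau_eig f_def N0 N1 NS rowN.
set F := \prod_(_ < _ | _) _ in f_def.
pose H := horner_mx A F.
have F0 : 0 < F.[k%:R].
  rewrite horner_prod; apply: prodr_gt0 => i i0; rewrite !hornerE subr_gt0 lt_neqAle.
  rewrite leA ?andbT; last by apply/tau_eig; exists i.
  by rewrite -tau0 inj_eq.
have annihF : horner_mx A (('X - (k%:R)%:P) * F) = 0.
  apply: symmetric_horner_eq0 => // a /tau_eig[i ->].
  have -> : ('X - (k%:R)%:P) * F = \prod_(i < d.+1) ('X - (tau i)%:P).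
    by rewrite (bigD1 ord0) //= tau0.
  by rewrite rootE horner_prod (bigD1 i) //= hornerXsubC subrr mul0r.
have AH : A *m H = k%:R *: H.
  apply/eqP; rewrite -subr_eq0; apply/eqP; move: annihF.
  rewrite rmorphM rmorphB /= horner_mx_X horner_mx_C -[_ * _]/(_ *m _).
  by rewrite mulmxBl mul_scalar_mx.
(* As a polynomial in [A], [H] commutes with [A]; so its rows, like its columns, lie in the
   eigenspace of [k]. *)
have HA : A *m H^T = k%:R *: H^T.
  rewrite -{1}symA -trmx_mul -linearZ /= -AH; congr (_^T).
  exact: comm_horner_mx.
have constl i i' j : H i j = H i' j.
  have [c /colP Hc] : exists c, col j H = const_mx c.
    by apply: kerA; rewrite !colE mulmxA AH -scalemxAl.
  by have := Hc i; have := Hc i'; rewrite !mxE => -> ->.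
have constr i j j' : H i j = H i j'.
  have [c /colP Hc] : exists c, col i H^T = const_mx c.
    by apply: kerA; rewrite !colE mulmxA HA -scalemxAl.
  by have := Hc j; have := Hc j'; rewrite !mxE => -> ->.
have H0 i j : 0 < H i j.
  have := horner_mx_eigen F A1; rewrite -/H => /colP/(_ i).
  rewrite !mxE mulr1 => sumH.
  have : 0 < \sum_(m < n.+1) H i j.
    rewrite (eq_bigr (fun m => H i m * (const_mx 1 : 'cV_n.+1) m 0)) ?sumH // => m _.
    by rewrite mxE mulr1; apply: constr.
  by rewrite sumr_const card_ord pmulrn_lgt0.
have hornerN l : horner_mx A (nbpoly R k l) = \matrix_(i, j) (N l i j)%:R.
  suff: horner_mx A (nbpoly R k l) = \matrix_(i, j) (N l i j)%:R
     /\ horner_mx A (nbpoly R k l.+1) = \matrix_(i, j) (N l.+1 i j)%:R by case.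
  elim: l => [|l [IH1 IH2]].
    split; first by rewrite rmorph1; apply/matrixP => i j; rewrite !mxE N0.
    by rewrite /= horner_mx_X; apply/matrixP => i j; rewrite !mxE.
  split=> //; apply/matrixP => i j; rewrite !mxE.
  (* The coefficient [k - (l != 0)] is [k] at [l = 0] and [k - 1] afterwards, which covers the
     exceptional second polynomial and the general recurrence at once. *)
  have -> : (N l.+2 i j)%:R
      = (\sum_m N 1 i m * N l.+1 m j)%:R - (k%:R - (l != 0)%:R) * (N l i j)%:R :> R.
    have /(congr1 (fun m => m%:R : R)) := NS l i j; rewrite !natrD !natrM.
    by set s := _%:R; lra.
  rewrite natr_sum (eq_bigr (fun m => A i m * (N l.+1 m j)%:R)); last first.
    by move=> m _; rewrite natrM N1.
  have -> : nbpoly R k l.+2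
      = 'X * nbpoly R k l.+1 - (k%:R - (l != 0)%:R)%:P * nbpoly R k l.
    by case: (l) => //=; rewrite subr0 mulr1 expr2.
  rewrite rmorphB !rmorphM /= horner_mx_X horner_mx_C IH1 IH2 -![_ * _]/(_ *m _).
  rewrite mul_scalar_mx !mxE; congr (_ - _).
  by apply: eq_bigr => m _; rewrite !mxE.
(* Otherwise every term [f l * N l ord0 j] would be nonpositive, and so would their sum
   [H ord0 j]. *)
have posN j : (0 < \sum_(l < d.+1 | (0 < f l)%R) N l ord0 j)%N.
  rewrite lt0n; apply/negP => /eqP sum0; have := H0 ord0 j; apply/negP; rewrite -leNgt.
  rewrite /H f_def linear_sum summxE /=; apply: sumr_le0 => l _.
  rewrite linearZ /= hornerN !mxE; have [f0|f0] := leP (f l) 0.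
    by apply: mulr_le0_ge0.
  move/eqP: sum0; rewrite sum_nat_eq0 => /forallP/(_ l); rewrite f0 /= => /eqP->.
  by rewrite mulr0.
apply: (@leq_trans (\sum_(j < n.+1) \sum_(l < d.+1 | (0 < f l)%R) N l ord0 j)%N).
  by rewrite -[leqLHS]card_ord -sum1_card; apply: leq_sum.
by rewrite exchange_big /=; apply: leq_sum => l _; rewrite rowN.
Qed.

(** * Counting non-backtracking walks *)

Local Open Scope nat_scope.

Lemma multC (G : multigraph) (u v : vertex G) : mult u v = mult v u.
Proof. by rewrite /mult setUC. Qed.

(* The number of non-backtracking walks from u to v of length i.+1 whose first
   edge is e.  A loop traversed twice in a row counts as backtracking. *)
Fixpoint nbwalk_from (G : multigraph) (i : nat) (u : vertex G) (e : edge G)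
    (v : vertex G) : nat :=
  if i is i'.+1 then
    \sum_(w | ends e == [set u; w]) \sum_(e' | e' != e) nbwalk_from i' w e' v
  else ends e == [set u; v].

Definition nbwalk (G : multigraph) (i : nat) (u v : vertex G) : nat :=
  if i is i'.+1 then \sum_e nbwalk_from i' u e v else u == v.

Lemma nbwalk1 (G : multigraph) (u v : vertex G) : nbwalk 1 u v = mult u v.
Proof. by rewrite /= /mult cardsE -sum1_card [RHS]big_mkcond. Qed.

Lemma ends_inj (G : multigraph) (e : edge G) (u w w' : vertex G) :
  ends e = [set u; w] -> ends e = [set u; w'] -> w = w'.
Proof.
move=> -> eqE; have := set21 u w'; have := set22 u w.
rewrite {1}eqE; move: (set22 u w'); rewrite -{1}eqE !inE.
by case/orP=> /eqP-> //; case/orP=> /eqP->.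
Qed.

(** The sum has at most one term; it is empty when [e] is not incident with [u], and then no walk
    from [u] starts with [e]. *)
Lemma nbwalk_from_sum (G : multigraph) i (u : vertex G) (e : edge G) v :
  \sum_(w | ends e == [set u; w]) nbwalk_from i u e v = nbwalk_from i u e v.
Proof.
case: (pickP (fun w => ends e == [set u; w])) => [w0 /eqP e0 | no].
  rewrite (big_pred1 w0) // => w /=.
  by apply/eqP/eqP => [/ends_inj/(_ e0) | ->].
rewrite big_pred0 //; case: i => [|i] /=; first by rewrite no.
by rewrite big_pred0.
Qed.

Lemma nbwalk_split (G : multigraph) i (u : vertex G) (e : edge G) v :
  nbwalk i.+1 u v = nbwalk_from i u e v + \sum_(e' | e' != e) nbwalk_from i u e' v.
Proof. by rewrite /nbwalk (bigD1 e). Qed.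

(* Prepending e to a walk of length i.+1 from w either gives a non-backtracking
   walk, or the walk from w already started with e; the remainder of the latter
   is then a walk from u that does not start with e. *)
Lemma nbwalk_from_rec (G : multigraph) i (u : vertex G) (e : edge G) v :
  nbwalk_from i.+1 u e v + \sum_(w | ends e == [set u; w]) nbwalk i u v
  = \sum_(w | ends e == [set u; w]) nbwalk i.+1 w v
    + (if i is i'.+1 then nbwalk_from i' u e v else 0).
Proof.
(* Walks from [u] that avoid [e] as first edge correspond to walks from [w] that start with [e]. At
   [i = 0] both sides say whether [v] is [u]. *)
have backtrack w : ends e = [set u; w] ->
    nbwalk i u v = nbwalk_from i w e v
      + (if i is i'.+1 then nbwalk_from i' u e v else 0).
  move=> e_uw; have e_wu : ends e = [set w; u] by rewrite setUC.
  case: i => [|i].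
    rewrite /= addn0; congr nat_of_bool; apply/eqP/eqP => [<- // | e_wv].
    exact: ends_inj e_wu e_wv.
  rewrite (nbwalk_split i u e) addnC; congr (_ + _) => /=.
  rewrite (big_pred1 u) // => w' /=.
  by apply/eqP/eqP => [/ends_inj/(_ e_wu) | ->].
set r := (if i is i'.+1 then nbwalk_from i' u e v else 0) in backtrack *.
transitivity (\sum_(w | ends e == [set u; w]) (nbwalk i.+1 w v + r)).
  rewrite [nbwalk_from i.+1 _ _ _]/= -big_split; apply: eq_bigr => w /eqP e_uw.
  rewrite (backtrack w e_uw) (nbwalk_split i w e) /= addnA; congr (_ + _).
  exact: addnC.
rewrite big_split; congr (_ + _).
rewrite /r; case: i {backtrack r} => [|i]; first by rewrite sum_nat_const muln0.
exact: nbwalk_from_sum.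
Qed.

Lemma sum_ends (G : multigraph) (F : vertex G -> nat) u :
  \sum_e \sum_(w | ends e == [set u; w]) F w = \sum_w mult u w * F w.
Proof.
rewrite (exchange_big_dep predT) //=; apply: eq_bigr => w _.
by rewrite sum_nat_const /mult cardsE.
Qed.

(** Sum [nbwalk_from_rec] over all edges [e]; by regularity [k] of them contain [u]. *)
Lemma nbwalk_rec (G : multigraph) k i (u v : vertex G) :
  mg_regular G k ->
  nbwalk i.+2 u v + k * nbwalk i u v
  = \sum_w mult u w * nbwalk i.+1 w v + (i != 0) * nbwalk i u v.
Proof.
move=> regG; have := @eq_bigr _ 0 addn _ (index_enum _) predT _ _
  (fun e _ => nbwalk_from_rec i u e v).
rewrite !big_split !sum_ends -[LHS]/(nbwalk i.+2 u v + _) -big_distrl /= regG => ->.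
by congr (_ + _); case: i => [|i]; rewrite ?mul1n // sum_nat_const muln0.
Qed.

Lemma sum_nbwalk (G : multigraph) k i (u : vertex G) :
  mg_regular G k -> \sum_v nbwalk i u v = nbnum k i.
Proof.
move=> regG; suff: forall u : vertex G, \sum_v nbwalk i u v = nbnum k i
        /\ \sum_v nbwalk i.+1 u v = nbnum k i.+1 by move=> /(_ u)[].
elim: i => [|i IH] {}u.
  split; last by rewrite (eq_bigr _ (fun v _ => nbwalk1 u v)) regG /= expn0 muln1.
  by rewrite /= (bigD1 u) //= eqxx big1 // => v /negPf; rewrite eq_sym => ->.
split; first by case: (IH u).
have step : \sum_v nbwalk i.+2 u v + k * \sum_v nbwalk i u v
    = k * nbnum k i.+1 + (i != 0) * \sum_v nbwalk i u v.
  rewrite -{2}(regG u) big_distrl !big_distrr -big_split /=.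
  rewrite (eq_bigr _ (fun v _ => nbwalk_rec i u v regG)) big_split exchange_big.
  congr (_ + _); apply: eq_bigr => w _.
  by rewrite -big_distrr; case: (IH w) => _ ->.
have [row_i _] := IH u; move: step; rewrite row_i.
(* Since [k.-1] is truncated, [k = 0] is treated apart. *)
case: i {IH row_i} => [|i] /=; first by case: (k) => [|m]; nia.
by rewrite mul1n !expnS; case: (k) => [|m]; rewrite ?mul0n ?addn0 //=; nia.
Qed.

(* The largest eigenvalue of a connected regular multigraph *)
Local Close Scope nat_scope.

(** Compare both sides of the eigenvalue equation at a vertex where the absolute value of [g] is
    largest. *)
Lemma regular_eigen_le (R : realFieldType) (G : multigraph) k
    (g : vertex G -> R) (a : R) u0 :
  mg_regular G k -> g u0 != 0 -> (forall u, \sum_v (mult u v)%:R * g v = a * g u) -> a <= k%:R.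
Proof.
move=> regG g0 gE.
case: (arg_maxP (fun u => `|g u|) (isT : predT u0)) => u _ max_u.
have gu : 0 < `|g u| by apply: lt_le_trans (max_u u0 isT); rewrite normr_gt0.
rewrite -(ler_pM2r gu); apply: (@le_trans _ _ `|a * g u|).
  by rewrite normrM ler_wpM2r ?ler_norm.
rewrite -gE -(regG u) natr_sum mulr_suml; apply: le_trans (ler_norm_sum _ _ _) _.
by apply: ler_sum => v _; rewrite normrM ger0_norm // ler_wpM2l //; apply: max_u.
Qed.

(** Maximum principle: [g] at a vertex is the average over its neighbours, so a maximum spreads
    along every path. *)
Lemma regular_eigen_const (R : realFieldType) (G : multigraph) k
    (g : vertex G -> R) :
  mg_regular G k -> mg_connected G ->
  (forall u, \sum_v (mult u v)%:R * g v = k%:R * g u) -> forall u v, g u = g v.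
Proof.
move=> regG connG gE u0 v0.
case: (arg_maxP g (isT : predT u0)) => m _ max_m.
suff gm v : g v = g m by rewrite !gm.
have /connectP[p] := connG m v.
elim/last_ind: p v => [|p w IHp] v /=; first by move=> _ ->.
rewrite rcons_path last_rcons => /andP[/IHp/(_ erefl)].
set x := last m p => gx adj ->; move/eqP: (gE x).
rewrite eq_sym -subr_eq0 -{1}(regG x) natr_sum mulr_suml -sumrB.
(* The terms [mult x y * (g x - g y)] are nonnegative with sum zero, hence all zero. *)
rewrite psumr_eq0; last first.
  by move=> y _; rewrite -mulrBr mulr_ge0 // subr_ge0 gx; apply: max_m.
move/allP/(_ w (mem_index_enum _)); rewrite -mulrBr mulf_eq0 pnatr_eq0 gx.
by rewrite eqn0Ngt adj subr_eq0 => /eqP.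
Qed.

Theorem corollary2p4 (R : rcfType) (G : multigraph) (k d : nat)
    (tau f : 'I_d.+1 -> R)
    (connG : mg_connected G) (regG : mg_regular G k)
    (tau_inj : injective tau) (tau0 : tau ord0 = k%:R)
    (tau_eig : forall x : R,
       eigenvalue (adjacency R G) x <-> exists i : 'I_d.+1, x = tau i)
    (f_def : \prod_(i < d.+1 | i != ord0) ('X - (tau i)%:P)
             = \sum_(i < d.+1) f i *: nbpoly R k i) :
  (mg_order G <= \sum_(i < d.+1 | (0 < f i)%R) nbnum k i)%N.
Proof.
have sumE (F : vertex G -> R) :
    \sum_(i < mg_order G) F (enum_val i) = \sum_v F v.
  by rewrite [RHS](reindex _ (onW_bij _ (enum_val_bij _))).
have sumnE (F : vertex G -> nat) :
    (\sum_(i < mg_order G) F (enum_val i) = \sum_v F v)%N.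
  by rewrite [RHS](reindex _ (onW_bij _ (enum_val_bij _))).
have symA : (adjacency R G)^T = adjacency R G.
  by apply/matrixP => i j; rewrite !mxE multC.
have eigE (x : 'cV[R]_(mg_order G)) (a : R) :
    adjacency R G *m x = a *: x -> let g v := x (enum_rank v) 0 in
    forall u, \sum_v (mult u v)%:R * g v = a * g u.
  move=> Ax g u; have /colP/(_ (enum_rank u)) := Ax; rewrite !mxE => <-.
  by rewrite -sumE; apply: eq_bigr => j _; rewrite mxE /g enum_valK enum_rankK.
apply: (@order_le_of_walk_counts R _ k d (adjacency R G) tau f
  (fun l i j => nbwalk l (enum_val i) (enum_val j))) => //.
- apply/colP => i; rewrite !mxE mulr1 -(regG (enum_val i)) natr_sum.
  by rewrite -sumE; apply: eq_bigr => j _; rewrite !mxE mulr1.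
- move=> x /eigE gE; have gC := regular_eigen_const regG connG gE.
  case: (pickP (@predT 'I_(mg_order G))) => [i0 _ | no]; last first.
    by exists 0; apply/colP => i; have := no i.
  exists (x i0 0); apply/colP => i; rewrite mxE.
  by have := gC (enum_val i) (enum_val i0); rewrite /= !enum_valK.
(* Symmetry of the matrix turns the row eigenvector into a column one. *)
- move=> a /eigenvalueP[v /(congr1 trmx)]; rewrite trmx_mul symA linearZ /= => /eigE gE.
  case/rV0Pn => i vi; apply: (regular_eigen_le (u0 := enum_val i) regG _ gE).
  by rewrite /= enum_valK mxE.
- by move=> i j; rewrite /= (inj_eq enum_val_inj).
- by move=> i j; rewrite mxE nbwalk1.
- move=> l i j; rewrite nbwalk_rec // -sumnE; congr (_ + _)%N.
  by apply: eq_bigr => m _; rewrite nbwalk1.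
- by move=> l i; rewrite sumnE; apply: sum_nbwalk.
Qed.
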